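(* Let $\Lambda\in\mathrm{Lin}^{\mathbb{R}}(\mathbb{H})$. 1. If $\Lambda\in\mathrm{Lin}^{\mathbb{C}}_{gg}(\mathbb{H}_l,\mathbb{H}_r)$ for some $g\in\mathbb{S}$, then $\Lambda\in\mathrm{Lin}^{\mathbb{R}}_{\mathcal{RF}}(\mathbb{H})$. Now assume $\Lambda\in\mathrm{Lin}^{\mathbb{R}}_{\mathcal{RF}}(\mathbb{H})$, denote by $c(\Lambda)$ the maximum number of linearly independent elements $g\in\mathbb{S}$ such that $\Lambda\in\mathrm{Lin}^{\mathbb{C}}_{gg}(\mathbb{H}_l,\mathbb{H}_r)$ and fix an orthonormal basis $\mathcal{B}=(1,e_1,e_2,e_3)$ of $\mathbb{H}$. Then: 2. If $g=g_1e_1+g_2e_2+g_3e_3\in\mathbb{S}$, then $$\Lambda\in\mathrm{Lin}^{\mathbb{C}}_{gg}(\mathbb{H}_l,\mathbb{H}_r)\Longleftrightarrow\mathcal{M}_\Lambda(g,g)=0\Longleftrightarrow\begin{bmatrix} g_1 \\ g_2 \\ g_3 \end{bmatrix}\in\ker(M_{\Lambda,\mathcal{B}})\,.$$ 3. $c(\Lambda)=\dim\ker(M_{\Lambda,\mathcal{B}})$. 4. $c(\Lambda)=3-s(\Lambda)$.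
   Context: $\mathbb{H}$ is the algebra of real quaternions, with scalar product $\langle x,y\rangle=\mathrm{Re}(x\bar y)$ and norm $|x|$; $\mathrm{Im}(\mathbb{H})$ is the space of quaternions with zero real part; $\mathbb{S}=\{x\in\mathrm{Im}(\mathbb{H}):|x|=1\}$. For $p\in\mathbb{H}\setminus\{0\}$, $\bar\vartheta_p(x):=p\bar xp^{-1}$; for $\lambda\in\mathbb{H}$, $\lambda\bar\vartheta_p$ denotes $x\mapsto\lambda\bar\vartheta_p(x)$. For $p\in\mathbb{H}$, $L_p(x):=px$ and $R_p(x):=xp$. $\mathrm{Lin}^{\mathbb{R}}(\mathbb{H})$ is the space of real linear maps $\mathbb{H}\to\mathbb{H}$. For $g,h\in\mathbb{S}$, $\mathrm{Lin}^{\mathbb{C}}_{gh}(\mathbb{H}_l,\mathbb{H}_r)$ is the set of $\Lambda\in\mathrm{Lin}^{\mathbb{R}}(\mathbb{H})$ with $\Lambda(gx)=\Lambda(x)h$ for all $x\in\mathbb{H}$. $\mathrm{Lin}^{\mathbb{R}}_{\mathcal{RF}}(\mathbb{H})$ is the set of $\Lambda\in\mathrm{Lin}^{\mathbb{R}}(\mathbb{H})$ such that $\sum_{\ell=0}^3\Lambda(e_\ell)e_\ell=0$ for one (equivalently any) orthonormal basis $(e_0,e_1,e_2,e_3)$ of $\mathbb{H}$ with $e_0=1$. Given any orthogonal basis $(e_1,e_2,e_3)$ of $\mathrm{Im}(\mathbb{H})$, each $\Lambda\in\mathrm{Lin}^{\mathbb{R}}_{\mathcal{RF}}(\mathbb{H})$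 decomposes uniquely as $\Lambda=\sum_{\ell=1}^3\lambda_\ell\bar\vartheta_{e_\ell}$ with $\lambda_\ell\in\mathbb{H}$; the size $s(\Lambda)$ is the minimal number of nonzero $\lambda_\ell$'s over all choices of orthogonal bases $(e_1,e_2,e_3)$ of $\mathrm{Im}(\mathbb{H})$. The real scalar product on $\mathrm{Lin}^{\mathbb{R}}(\mathbb{H})$ is $\langle\Gamma,\Lambda\rangle:=\frac14\sum_{\ell=0}^3\langle\Gamma(e_\ell),\Lambda(e_\ell)\rangle$ for any orthonormal basis $(e_0,e_1,e_2,e_3)$ of $\mathbb{H}$ (independent of the choice). To $\Lambda\in\mathrm{Lin}^{\mathbb{R}}(\mathbb{H})$ one associates the bilinear forms on $\mathrm{Im}(\mathbb{H})$ $$\mathcal{A}_\Lambda(p,q)=\langle R_p\circ\Lambda,\Lambda\circ L_q\rangle,\qquad\mathcal{M}_\Lambda(p,q)=\tfrac12\mathrm{tr}(\mathcal{A}_\Lambda)\langle p,q\rangle-\tfrac12\mathcal{A}_\Lambda(p,q),$$ where the trace is that of the matrix of $\mathcal{A}_\Lambda$ in an orthonormal basis of $\mathrm{Im}(\mathbb{H})$. For an orthonormal basis $\mathcal{B}=(1,e_1,e_2,e_3)$ of $\mathbb{H}$, $M_{\Lambda,\mathcal{B}}=(\mathcal{M}_\Lambda(e_\alpha,e_\beta))_{\alpha,\beta=1}^3$. *)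

(* Defs.v *)
From HB Require Import structures.
From mathcomp Require Import all_boot all_order all_algebra all_field.
From mathcomp Require Import boolp reals ring lra.
Set Implicit Arguments.
Unset Strict Implicit.
Unset Printing Implicit Defensive.
Import Order.TTheory GRing.Theory Num.Theory.
Local Open Scope ring_scope.

(* The quaternion a + b i + c j + d k is encoded as the row (a, b, c, d);
   the alias carries the Hamilton product. *)
Definition quat (R : realType) : Type := 'rV[R]_4.

HB.instance Definition _ (R : realType) := Vector.on (quat R).

Section QuaternionAlgebra.
Variable R : realType.
Implicit Types x y z : quat R.

Definition mkq (a b c d : R) : quat R := \row_(i < 4) [:: a; b; c; d]`_i.
Definition qcoord x (n : nat) : R := x 0 (inord n).

Lemma qcoordE a b c d :
  (qcoord (mkq a b c d) 0 = a) * (qcoord (mkq a b c d) 1 = b) *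
  (qcoord (mkq a b c d) 2 = c) * (qcoord (mkq a b c d) 3 = d).
Proof. by rewrite /qcoord !mxE !inordK. Qed.

Lemma qcoordD x y n : qcoord (x + y) n = qcoord x n + qcoord y n.
Proof. by rewrite /qcoord mxE. Qed.
Lemma qcoordZ a x n : qcoord (a *: x) n = a * qcoord x n.
Proof. by rewrite /qcoord mxE. Qed.
Lemma qcoord0 n : qcoord 0 n = 0.
Proof. by rewrite /qcoord mxE. Qed.

Lemma quatP x y : qcoord x 0 = qcoord y 0 -> qcoord x 1 = qcoord y 1 ->
  qcoord x 2 = qcoord y 2 -> qcoord x 3 = qcoord y 3 -> x = y.
Proof.
move=> h0 h1 h2 h3; apply/rowP => i; rewrite -(inord_val i).
by case: i => -[|[|[|[|//]]]].
Qed.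

Definition qmul x y : quat R :=
  let x0 := qcoord x 0 in let x1 := qcoord x 1 in
  let x2 := qcoord x 2 in let x3 := qcoord x 3 in
  let y0 := qcoord y 0 in let y1 := qcoord y 1 in
  let y2 := qcoord y 2 in let y3 := qcoord y 3 in
  mkq (x0 * y0 - x1 * y1 - x2 * y2 - x3 * y3)
      (x0 * y1 + x1 * y0 + x2 * y3 - x3 * y2)
      (x0 * y2 - x1 * y3 + x2 * y0 + x3 * y1)
      (x0 * y3 + x1 * y2 - x2 * y1 + x3 * y0).

Definition qone : quat R := mkq 1 0 0 0.

Fact qmulA : associative qmul.
Proof. by move=> x y z; apply: quatP; rewrite !qcoordE; ring. Qed.
Fact qmul1 : left_id qone qmul.
Proof. by move=> x; apply: quatP; rewrite !qcoordE; ring. Qed.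
Fact qmulr1 : right_id qone qmul.
Proof. by move=> x; apply: quatP; rewrite !qcoordE; ring. Qed.
Fact qmulDl : left_distributive qmul +%R.
Proof. by move=> x y z; apply: quatP; rewrite !(qcoordE, qcoordD); ring. Qed.
Fact qmulDr : right_distributive qmul +%R.
Proof. by move=> x y z; apply: quatP; rewrite !(qcoordE, qcoordD); ring. Qed.
Fact qone_neq0 : qone != 0.
Proof.
by apply/eqP => /(congr1 (qcoord^~ 0)) /eqP; rewrite qcoordE qcoord0 oner_eq0.
Qed.

HB.instance Definition _ := GRing.Zmodule_isNzRing.Build (quat R)
  qmulA qmul1 qmulr1 qmulDl qmulDr qone_neq0.

Fact qscaleAl (a : R) x y : a *: (x * y) = (a *: x) * y.
Proof. by apply: quatP; rewrite !(qcoordE, qcoordZ); ring. Qed.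
Fact qscaleAr (a : R) x y : a *: (x * y) = x * (a *: y).
Proof. by apply: quatP; rewrite !(qcoordE, qcoordZ); ring. Qed.

HB.instance Definition _ := GRing.Lmodule_isLalgebra.Build R (quat R) qscaleAl.
HB.instance Definition _ := GRing.Lalgebra_isAlgebra.Build R (quat R) qscaleAr.

Definition qre x : R := qcoord x 0.

Definition qconj x : quat R :=
  mkq (qcoord x 0) (- qcoord x 1) (- qcoord x 2) (- qcoord x 3).

Definition qdot x y : R := qre (x * qconj y).

Lemma qdotE x y : qdot x y = qcoord x 0 * qcoord y 0 + qcoord x 1 * qcoord y 1
  + qcoord x 2 * qcoord y 2 + qcoord x 3 * qcoord y 3.
Proof. by rewrite /qdot /qre !qcoordE; ring. Qed.

Lemma qdot_eq0 x : (qdot x x == 0) = (x == 0).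
Proof.
apply/eqP/eqP => [|->]; last by rewrite qdotE !qcoord0; ring.
by rewrite qdotE => h; apply: quatP; rewrite qcoord0; nra.
Qed.

Lemma qmul_conjl x : qconj x * x = (qdot x x)%:A.
Proof.
by rewrite qdotE; apply: quatP; rewrite !(qcoordE, qcoordZ); ring.
Qed.

Lemma qmul_conjr x : x * qconj x = (qdot x x)%:A.
Proof.
by rewrite qdotE; apply: quatP; rewrite !(qcoordE, qcoordZ); ring.
Qed.

Definition qinv x : quat R := (qdot x x)^-1 *: qconj x.

Fact qmulVr : {in predC1 (0 : quat R), left_inverse 1 qinv *%R}.
Proof.
move=> x; rewrite inE /= => x0.
by rewrite /qinv -scalerAl qmul_conjl scalerA mulVf ?scale1r ?qdot_eq0.
Qed.
Fact qmulrV : {in predC1 (0 : quat R), right_inverse 1 qinv *%R}.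
Proof.
move=> x; rewrite inE /= => x0.
by rewrite /qinv -scalerAr qmul_conjr scalerA mulVf ?scale1r ?qdot_eq0.
Qed.
Fact quat_unitP x y : y * x = 1 /\ x * y = 1 -> predC1 (0 : quat R) x.
Proof.
by case=> _ xy; apply/eqP => x0; move/eqP: xy; rewrite x0 mul0r eq_sym oner_eq0.
Qed.
Fact qinv_out : {in [predC predC1 (0 : quat R)], qinv =1 id}.
Proof.
move=> x; rewrite !inE negbK => /eqP ->.
by apply: quatP; rewrite qcoordZ !qcoordE !qcoord0; ring.
Qed.

HB.instance Definition _ := GRing.NzRing_hasMulInverse.Build (quat R)
  qmulVr qmulrV quat_unitP qinv_out.

Fact qre_is_linear : linear (qre : quat R -> R^o).
Proof. by move=> a x y; rewrite /qre qcoordD qcoordZ. Qed.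
HB.instance Definition _ := GRing.isLinear.Build R (quat R) R^o _
  (qre : quat R -> R^o) qre_is_linear.

End QuaternionAlgebra.

Section RealLinearMaps.
Variable R : realType.
Local Notation H := (quat R).

Definition qnorm (x : H) : R := Num.sqrt (qdot x x).

Definition imH : {vspace H} := lker (linfun (@qre R : H -> R^o)).

Lemma imHP (x : H) : reflect (qre x = 0) (x \in imH).
Proof. by rewrite memv_ker lfunE; exact: eqP. Qed.

Definition in_sphere (g : H) : Prop := g \in imH /\ qnorm g = 1.

Definition thetab (p x : H) : H := p * qconj x / p.

Definition qorthonormal n (e : n.-tuple H) : Prop :=
  forall i j, qdot (tnth e i) (tnth e j) = (i == j)%:R.

Definition orthonormal_basisH (e : 4.-tuple H) : Prop :=
  basis_of fullv e /\ qorthonormal e.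

Definition orthogonal_basis_imH (e : 3.-tuple H) : Prop :=
  basis_of imH e /\
  forall i j, i != j -> qdot (tnth e i) (tnth e j) = 0.

Definition LinC (g h : H) (L : 'End(H)) : Prop :=
  forall x, L (g * x) = L x * h.

Definition LinRF (L : 'End(H)) : Prop :=
  exists e : 4.-tuple H, [/\ orthonormal_basisH e, tnth e ord0 = 1 &
    \sum_(l < 4) L (tnth e l) * tnth e l = 0].

(* Evaluated on the basis (1, i, j, k), whose elements are the unit vectors of
   'rV_4; the value is the same for every orthonormal basis. *)
Definition ldot (G L : 'End(H)) : R :=
  4^-1 * \sum_(l < 4) qdot (G (delta_mx 0 l)) (L (delta_mx 0 l)).

(* amulr p is right multiplication by p, amull q is left multiplication by q.
   Both forms below are only meant to be used on imH. *)
Definition formA (L : 'End(H)) (p q : H) : R :=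
  ldot (amulr p \o L)%VF (L \o amull q)%VF.

Definition gram (B : H -> H -> R) (e : 'I_3 -> H) : 'M[R]_3 :=
  \matrix_(a, b) B (e a) (e b).

(* The standard units (i, j, k). *)
Definition imunit (a : 'I_3) : H := delta_mx 0 (lift ord0 a).

Definition formM (L : 'End(H)) (p q : H) : R :=
  2^-1 * \tr (gram (formA L) imunit) * qdot p q - 2^-1 * formA L p q.

Definition impart (e : 4.-tuple H) (a : 'I_3) : H := tnth e (lift ord0 a).

Definition matM (L : 'End(H)) (e : 4.-tuple H) : 'M[R]_3 :=
  gram (formM L) (impart e).

(* Kernel of v |-> M v on column vectors (kermx is the row kernel). *)
Definition cker (M : 'M[R]_3) : {vspace 'cV[R]_3} :=
  lker (linfun (mulmx M : 'cV[R]_3 -> 'cV[R]_3)).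

Lemma ckerP (M : 'M[R]_3) (v : 'cV[R]_3) : reflect (M *m v = 0) (v \in cker M).
Proof. by rewrite memv_ker lfunE; exact: eqP. Qed.

Definition free_LinC_family (L : 'End(H)) (k : nat) : Prop :=
  exists g : k.-tuple H,
    free g /\ forall i, in_sphere (tnth g i) /\ LinC (tnth g i) (tnth g i) L.

(* A free family in quat R has at most 4 elements, so k < 5 is no restriction. *)
Definition cnum (L : 'End(H)) : nat :=
  (\max_(k < 5 | `[< free_LinC_family L k >]) k)%N.

Definition decomposable_with (L : 'End(H)) (k : nat) : Prop :=
  exists (e : 3.-tuple H) (lam : 'I_3 -> H),
    [/\ orthogonal_basis_imH e,
        forall x, L x = \sum_(l < 3) lam l * thetab (tnth e l) x &
        #|[set l | lam l != 0]| = k].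

(* Least k <= 3 with decomposable_with L k, which exists whenever LinRF L;
   outside LinRF the value is irrelevant. *)
Definition size_RF (L : 'End(H)) : nat :=
  [arg min_(k < (ord_max : 'I_4) | `[< decomposable_with L k >]) (k : nat)]%N.

End RealLinearMaps.

(* Main.v *)
Require Import Defs.
From HB Require Import structures.
From mathcomp Require Import all_boot all_order all_algebra all_field.
From mathcomp Require Import boolp reals zify ring lra.
Set Implicit Arguments.
Unset Strict Implicit.
Unset Printing Implicit Defensive.
Import Order.TTheory GRing.Theory Num.Theory.
Local Open Scope ring_scope.

(** Write L for Lambda, and measure how far L is from being left multiplication
    by L(1) through its defect T(p) = L(p) - L(1) p, a real linear map (written
    [defect L]).  For L in LinRF, every object of the theorem is controlled by
    one subspace, the space C of the imaginary quaternions in the kernel of T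
    (written [cspace L]).

    The sum of the L(e_l) e_l is the trace of the bilinear map
    (x, y) |-> L(x) y, hence the same for all orthonormal bases
    ([qtrace_orthogonal]).  If L(g x) = L(x) g with g a unit imaginary
    quaternion, then computing it in the basis g e_l turns it into its
    opposite, as g^2 = -1; so it vanishes and L is in LinRF.

    For L in LinRF and g imaginary, the relation
      L(g x) = L(x) g + T(g) conj(x)
    holds ([lfun_mul_imH]): it is immediate for x = 1 and x = g, and for x
    orthogonal to both it is the vanishing of the trace in the orthogonal
    basis (1, g, x, g x).  It shows at once that L is in LinC_gg iff T(g) = 0,
    and that A_L(p, q) = <p, q> |L|^2 - <T p, T q> / 2, whose trace is |L|^2.
    Therefore M_L(p, q) = <T p, T q> / 4 ([formM_defect]).  So M_L is positive
    semidefinite with kernel C, and M_L(g, g) = 0 iff g is in this kernel iff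
    T(g) = 0.  Moreover c(L) = dim C, since C has a basis of unit vectors.

    Finally, in a decomposition of L as the sum of the lam_l thetab_(e_l) along
    an orthogonal basis of the imaginary quaternions one has
    T(e_m) = - 2 lam_m e_m, so lam_m vanishes exactly when e_m lies in C.  At
    most dim C of the e_m do, with equality when (e_1, e_2, e_3) extends an
    orthogonal basis of C; and a decomposition exists along every orthogonal
    basis ([decomposition_exists]).  So s(L) = 3 - dim C. *)

(** * The Euclidean algebra of quaternions *)

Section Quaternions.
Variable R : realType.
Local Notation H := (quat R).
Implicit Types (g h p q x y : H) (i j : 'I_4).

Lemma qdotC x y : qdot x y = qdot y x.
Proof. by rewrite !qdotE; ring. Qed.

Fact qdot_is_linear x : linear (qdot x : H -> R^o).
Proof.
by move=> a y z; rewrite !qdotE !(qcoordD, qcoordZ) /GRing.scale /=; ring.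
Qed.
HB.instance Definition _ x :=
  GRing.isLinear.Build R H R^o _ (qdot x : H -> R^o) (qdot_is_linear x).

Lemma qdotDr x y z : qdot x (y + z) = qdot x y + qdot x z.
Proof. exact: linearD. Qed.
Lemma qdotBr x y z : qdot x (y - z) = qdot x y - qdot x z.
Proof. exact: linearB. Qed.
Lemma qdotZr (a : R) x y : qdot x (a *: y) = a * qdot x y.
Proof. exact: linearZ. Qed.
Lemma qdotBl x y z : qdot (x - y) z = qdot x z - qdot y z.
Proof. by rewrite qdotC qdotBr !(qdotC z). Qed.
Lemma qdotZl (a : R) x y : qdot (a *: x) y = a * qdot x y.
Proof. by rewrite qdotC qdotZr (qdotC y). Qed.
Lemma qdot_sumr (I : finType) (F : I -> H) x :
  qdot x (\sum_k F k) = \sum_k qdot x (F k).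
Proof. exact: linear_sum. Qed.
Lemma qdot_suml (I : finType) (F : I -> H) x :
  qdot (\sum_k F k) x = \sum_k qdot (F k) x.
Proof. by rewrite qdotC qdot_sumr; apply: eq_bigr => k _; rewrite qdotC. Qed.

Lemma qdot_ge0 x : 0 <= qdot x x.
Proof. by rewrite qdotE !addr_ge0 // -expr2 sqr_ge0. Qed.

Lemma qdotMl p x y : qdot (p * x) (p * y) = qdot p p * qdot x y.
Proof. by rewrite !qdotE !qcoordE; ring. Qed.
Lemma qdotMr p x y : qdot (x * p) (y * p) = qdot p p * qdot x y.
Proof. by rewrite !qdotE !qcoordE; ring. Qed.
Lemma qdot_mulr x y p : qdot x (y * p) = qdot (x * qconj p) y.
Proof. by rewrite !qdotE !qcoordE; ring. Qed.
Lemma qdot_mulr_conj x y p : qdot x (y * qconj p) = qdot (x * p) y.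
Proof. by rewrite !qdotE !qcoordE; ring. Qed.

Lemma qdot_mulr_imH x y p : p \in imH R -> qdot x (y * p) = - qdot (x * p) y.
Proof.
move=> /imHP; rewrite /qre => p0; rewrite !qdotE !qcoordE p0; ring.
Qed.

Lemma qdot1r x : qdot x 1 = qre x.
Proof. by rewrite qdotE !qcoordE /qre; ring. Qed.

Lemma qconj1 : qconj (1 : H) = 1.
Proof. by apply: quatP; rewrite !qcoordE; ring. Qed.

Fact qconj_is_linear : linear (@qconj R : H -> H).
Proof.
by move=> a x y; apply: quatP;
  rewrite ?(qcoordD, qcoordZ) !qcoordE ?(qcoordD, qcoordZ); ring.
Qed.
HB.instance Definition _ :=
  GRing.isLinear.Build R H H _ (@qconj R) qconj_is_linear.

Lemma qconjE x : qconj x = (2 * qre x) *: 1 - x.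
Proof.
apply: quatP; rewrite !qcoordD qcoordZ -scaleN1r qcoordZ !qcoordE /qre; ring.
Qed.

Lemma qconj_imH p : p \in imH R -> qconj p = - p.
Proof. by move=> /imHP p0; rewrite qconjE p0 mulr0 scale0r sub0r. Qed.

Lemma imH_sqr p : p \in imH R -> p * p = - (qdot p p)%:A.
Proof. by move=> pI; rewrite -qmul_conjr (qconj_imH pI) mulrN opprK. Qed.

Lemma imH_anticomm p q :
  p \in imH R -> q \in imH R -> qdot p q = 0 -> q * p = - (p * q).
Proof.
move=> /imHP p0 /imHP q0; rewrite /qre in p0 q0 *.
rewrite qdotE => pq; apply/eqP; rewrite -addr_eq0; apply/eqP.
apply: quatP; rewrite !qcoordD !qcoordE qcoord0 ?p0 ?q0; nra.
Qed.

Lemma imH1 p : p \in imH R -> qdot 1 p = 0.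
Proof. by move=> /imHP p0; rewrite qdotC qdot1r. Qed.

Lemma qre1 : qre (1 : H) = 1.
Proof. by rewrite /qre qcoordE. Qed.

Lemma qdot11 : qdot (1 : H) 1 = 1.
Proof. by rewrite qdot1r qre1. Qed.

Lemma big_ord4 (V : nmodType) (F : 'I_4 -> V) :
  \sum_(i < 4) F i = F 0 + F 1 + F 2 + F 3.
Proof.
rewrite !big_ord_recl big_ord0 addr0 !addrA.
by do !congr (_ + _); congr F; exact: val_inj.
Qed.

(** The units 1, i, j, k, as the standard basis of the row space. *)
Definition std i : H := delta_mx 0 i.

Lemma std0 : std 0 = 1.
Proof.
apply: quatP; rewrite ?[1]/(mkq 1 0 0 0) !qcoordE /qcoord !mxE eqxx /=;
  by rewrite -val_eqE /= inordK.
Qed.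

Lemma quat_sum_std x : x = \sum_i x 0 i *: std i.
Proof. exact: row_sum_delta. Qed.

Lemma qdot_sum_coord x y : qdot x y = \sum_i x 0 i * y 0 i.
Proof.
by rewrite qdotE big_ord4 /qcoord; do !congr (_ + _); congr (x 0 _ * y 0 _);
  apply: val_inj; rewrite /= inordK.
Qed.

Lemma qdot_std i j : qdot (std i) (std j) = (i == j)%:R.
Proof.
rewrite qdot_sum_coord (bigD1 i) //= big1 => [|k ki]; last first.
  by rewrite mxE (negbTE ki) andbF mul0r.
by rewrite !mxE !eqxx mul1r addr0.
Qed.

Lemma std_neq0 i : std i != 0.
Proof. by rewrite -qdot_eq0 qdot_std eqxx oner_eq0. Qed.

End Quaternions.

(** * The trace of L(x) y and the class LinRF *)

Section Trace.
Variable R : realType.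
Local Notation H := (quat R).
Implicit Types (L : 'End(H)) (g h p q x y : H).

Definition qtrace L : H := \sum_i L (std R i) * std R i.

(** Basis independence of a bilinear trace: if the rows of A are the e_i and B
    is A with its rows divided by the squared norms, then B A^T = 1, hence also
    A^T B = 1, and this is what expanding each e_i in the standard basis
    requires.  Dividing by the squared norms, instead of normalising the e_i,
    makes the lemma apply directly to bases such as (1, g, h, g h). *)
Lemma qtrace_orthogonal L (e : 'I_4 -> H) :
  (forall i, e i != 0) -> (forall i j, i != j -> qdot (e i) (e j) = 0) ->
  \sum_i (qdot (e i) (e i))^-1 *: (L (e i) * e i) = qtrace L.
Proof.
move=> e0 orth; pose A := \matrix_(i, k) e i 0 k.
pose B := \matrix_(i, k) ((qdot (e i) (e i))^-1 * e i 0 k).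
have BA : A^T *m B = 1%:M.
  apply: mulmx1C; apply/matrixP => i j; rewrite !mxE.
  under eq_bigr => k _ do rewrite !mxE -mulrA.
  rewrite -mulr_sumr -qdot_sum_coord.
  have [<-|ij] := eqVneq i j; first by rewrite mulVf ?qdot_eq0.
  by rewrite (orth _ _ ij) mulr0.
have bilin x y :
    L x * y = \sum_k \sum_m (x 0 k * y 0 m) *: (L (std R k) * std R m).
  rewrite {1}(quat_sum_std x) linear_sum mulr_suml; apply: eq_bigr => k _.
  rewrite {1}(quat_sum_std y) mulr_sumr; apply: eq_bigr => m _.
  by rewrite linearZ /= -scalerAl -scalerAr scalerA.
have step i : (qdot (e i) (e i))^-1 *: (L (e i) * e i) =
    \sum_k \sum_m (A^T k i * B i m) *: (L (std R k) * std R m).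
  rewrite bilin scaler_sumr; apply: eq_bigr => k _.
  rewrite scaler_sumr; apply: eq_bigr => m _.
  by rewrite scalerA !mxE mulrCA.
rewrite (eq_bigr _ (fun i _ => step i)) exchange_big; apply: eq_bigr => k _ /=.
have ABkm m : \sum_i A^T k i * B i m = (k == m)%:R.
  by move/matrixP/(_ k m): BA; rewrite !mxE.
rewrite exchange_big (bigD1 k) //= [X in _ + X]big1 => [|m mk].
  by rewrite addr0 -scaler_suml ABkm eqxx scale1r.
by rewrite -scaler_suml ABkm eq_sym (negbTE mk) scale0r.
Qed.

Lemma qtrace_orthonormal L (e : 4.-tuple H) :
  qorthonormal e -> \sum_(l < 4) L (tnth e l) * tnth e l = qtrace L.
Proof.
move=> on; rewrite -(@qtrace_orthogonal L (tnth e)) => [|i|i j /negbTE ij].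
- by apply: eq_bigr => i _; rewrite on eqxx invr1 scale1r.
- by rewrite -qdot_eq0 on eqxx oner_eq0.
- by rewrite on ij.
Qed.

(** Left multiplication by a nonzero quaternion is a similarity, so it carries
    the standard basis to an orthogonal one. *)
Lemma qtrace_mull L p : p != 0 ->
  \sum_i (qdot p p)^-1 *: (L (p * std R i) * (p * std R i)) = qtrace L.
Proof.
move=> p0.
rewrite -(@qtrace_orthogonal L (fun i => p * std R i)) => [|i|i j ij].
- by apply: eq_bigr => i _; rewrite qdotMl qdot_std eqxx mulr1.
- by rewrite -qdot_eq0 qdotMl mulf_neq0 ?qdot_eq0 // std_neq0.
- by rewrite qdotMl qdot_std (negbTE ij) mulr0.
Qed.

Lemma in_sphereP g : in_sphere g <-> g \in imH R /\ qdot g g = 1.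
Proof.
rewrite /in_sphere /qnorm; split=> -[gI g1]; split=> //; last first.
  by rewrite g1 sqrtr1.
by rewrite -[LHS]sqr_sqrtr ?qdot_ge0 // g1 expr1n.
Qed.

(** With u running over the standard basis, the trace is the sum of the
    L(g u) g u = L(u) g g u = - L(u) u, that is, its own opposite. *)
Lemma qtrace_LinC L g : in_sphere g -> LinC g g L -> qtrace L = 0.
Proof.
move=> /in_sphereP[gI g1] Lg.
have g0 : g != 0 by rewrite -qdot_eq0 g1 oner_eq0.
have /eqP : qtrace L = - qtrace L.
  rewrite -{1}(qtrace_mull L g0) /qtrace -sumrN; apply: eq_bigr => i _.
  rewrite g1 invr1 scale1r Lg -mulrA (mulrA g).
  by rewrite imH_sqr // g1 scale1r mulN1r mulrN.
by rewrite -subr_eq0 opprK -mulr2n -scaler_nat scaler_eq0 pnatr_eq0 => /eqP.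
Qed.

(** * The defect p |-> L(p) - L(1) p *)

Definition defect L : 'End(H) := (L - amull (L 1))%R.

Lemma defectE L p : defect L p = L p - L 1 * p.
Proof. by rewrite !lfunE /= !lfunE /= lfunE. Qed.

(** Both sides are linear in x, so x may be taken to be 1, g, or an imaginary h
    orthogonal to g.  The last case is the vanishing of the trace, computed in
    the orthogonal basis (1, g, h, g h) and multiplied on the right by g h. *)
Lemma lfun_mul_imH L g x : qtrace L = 0 -> g \in imH R ->
  L (g * x) = L x * g + defect L g * qconj x.
Proof.
move=> tr0 gI; have [->|g0] := eqVneq g 0.
  by rewrite !(mul0r, mulr0, linear0, addr0).
(* The Gram-Schmidt residue of x against 1 and g. *)
pose b := qdot g x / qdot g g; pose h := x - qre x *: 1 - b *: g.
have gg0 : qdot g g != 0 by rewrite qdot_eq0.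
have hI : h \in imH R.
  apply/imHP; rewrite /h !linearB !linearZ /= (imHP _ gI).
  by rewrite qre1 oppr0 scaler0 addr0 [_ *: _]mulrN1 subrr.
have gh : qdot g h = 0.
  rewrite /h !qdotBr !qdotZr -(qdotC 1) (imH1 gI) mulr0 subr0 /b.
  by rewrite divfK // subrr.
have -> : x = qre x *: 1 + b *: g + h.
  by rewrite /h -[x - _ - _]addrA -opprD [RHS]addrC subrK.
pose P y := L (g * y) = L y * g + defect L g * qconj y.
have PD y z : P y -> P z -> P (y + z).
  by rewrite /P mulrDr !linearD /= => -> ->; rewrite mulrDl mulrDr addrACA.
have PZ (a : R) y : P y -> P (a *: y).
  rewrite /P -scalerAr !linearZ /= => ->.
  by rewrite -scalerAl -scalerAr scalerDr.
apply: (PD); first apply: (PD); first apply: (PZ).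
- by rewrite /P defectE qconj1 !mulr1 addrC subrK.
- apply: (PZ); rewrite /P defectE qconj_imH // mulrN mulrBl -mulrA imH_sqr //.
  by rewrite opprB addrCA subrr addr0 linearN linearZ /= mulrN -scalerAr mulr1.
rewrite /P defectE (qconj_imH hI) mulrN.
have [->|h0] := eqVneq h 0; first by rewrite !(mulr0, mul0r, linear0, subr0).
have hh0 : qdot h h != 0 by rewrite qdot_eq0.
pose e i : H := [:: 1; g; h; g * h]`_i.
have orth1 : qdot 1 (g * h) = 0.
  by rewrite qdot_mulr_imH // mul1r qdotC gh oppr0.
have orthg : qdot g (g * h) = 0 by rewrite -{1}[g]mulr1 qdotMl imH1 ?mulr0.
have orthh : qdot h (g * h) = 0 by rewrite -{1}[h]mul1r qdotMr imH1 ?mulr0.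
have e0 (i : 'I_4) : e i != 0.
  case: i => -[|[|[|[|//]]]] ilt; rewrite /e //= ?oner_neq0 //.
  by rewrite -qdot_eq0 qdotMl mulf_neq0.
have orth (i j : 'I_4) : i != j -> qdot (e i) (e j) = 0.
  rewrite -val_eqE /=; case: i => -[|[|[|[|//]]]] ilt;
  case: j => -[|[|[|[|//]]]] jlt //= _; rewrite /e /=;
  by [rewrite imH1 | rewrite qdotC // imH1].
have := qtrace_orthogonal L e0 orth.
have ggh : g * (g * h) = - qdot g g *: h.
  by rewrite mulrA imH_sqr // mulNr -scalerAl mul1r scaleNr.
have hgh : h * (g * h) = qdot h h *: g.
  rewrite mulrA (imH_anticomm gI hI gh) mulNr -mulrA imH_sqr // mulrN opprK.
  by rewrite -scalerAr mulr1.
have ghgh : g * h * (g * h) = - (qdot g g * qdot h h)%:A.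
  by rewrite -mulrA hgh -scalerAr imH_sqr // scalerN scalerA mulrC.
rewrite tr0 big_ord4 /e /= qdot11 invr1 scale1r mulr1 qdotMl.
(* As (g h)^2 = - |g|^2 |h|^2, this cancels all the squared norms. *)
move=> /(congr1 (fun y => y * (g * h))).
rewrite mul0r !mulrDl -!scalerAl -!(mulrA (L _)) ggh hgh ghgh.
rewrite mulrN -!scalerAr !scalerN mulr1 !scalerA ?mulrN !mulVf ?mulf_neq0 //.
rewrite scaleNr !scale1r => /eqP; rewrite subr_eq0 => /eqP <-.
by rewrite mulNr opprB -mulrA addrC.
Qed.

Lemma LinC_defect L g : qtrace L = 0 -> g \in imH R ->
  LinC g g L <-> defect L g = 0.
Proof.
move=> tr0 gI; split=> [Lg | d0 x].
  by rewrite defectE -[g in L g]mulr1 Lg subrr.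
by rewrite lfun_mul_imH // d0 mul0r addr0.
Qed.

(** Call S this sum.  It is the trace of R_p o L, and in the basis p u that
    trace is minus the sum of the L(p u) u; by [lfun_mul_imH] the latter sum is
    S + 4 T(p), so that S = - S - 4 T(p). *)
Lemma qtrace_mul_imH L p : qtrace L = 0 -> p \in imH R ->
  \sum_i L (std R i) * p * std R i = - 2 *: defect L p.
Proof.
move=> tr0 pI; have [->|p0] := eqVneq p 0.
  by rewrite linear0 scaler0 big1 // => i _; rewrite mulr0 mul0r.
have pp0 : qdot p p != 0 by rewrite qdot_eq0.
have trE : \sum_i L (std R i) * p * std R i = qtrace (amulr p \o L).
  by apply: eq_bigr => i _; rewrite lfunE /= lfunE.
have trN : \sum_i L (std R i) * p * std R i =
    - \sum_i L (p * std R i) * std R i.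
  rewrite trE -(qtrace_mull _ p0) -sumrN; apply: eq_bigr => i _.
  rewrite lfunE /= lfunE /= -mulrA (mulrA p).
  rewrite imH_sqr // mulNr mulrN -scalerAl -scalerAr mul1r scalerN scalerA.
  by rewrite mulVf // scale1r.
have keyS : \sum_i L (p * std R i) * std R i =
    \sum_i L (std R i) * p * std R i + 4 *: defect L p.
  under eq_bigr => i _ do rewrite lfun_mul_imH // mulrDl.
  rewrite big_split /=; congr (_ + _).
  under eq_bigr => i _ do rewrite -mulrA qmul_conjl qdot_std eqxx scale1r mulr1.
  by rewrite sumr_const card_ord scaler_nat.
have /eqP := trN; rewrite keyS opprD -subr_eq0 opprD !opprK addrA -mulr2n.
rewrite addr_eq0 => /eqP S2.
apply: (@scalerI _ _ (2 : R)); first by rewrite pnatr_eq0.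
by rewrite scaler_nat S2 scalerA -scaleNr; congr (_ *: _); ring.
Qed.

Lemma ldotE (G L : 'End(H)) :
  ldot G L = 4^-1 * \sum_i qdot (G (std R i)) (L (std R i)).
Proof. by []. Qed.

(** Expand L(q u) by [lfun_mul_imH]: the term L(u) q pairs with L(u) p into
    <p, q> |L(u)|^2, and moving conj(u) across the scalar product turns the
    other term into the sum of [qtrace_mul_imH]. *)
Lemma formA_defect L p q : qtrace L = 0 -> p \in imH R -> q \in imH R ->
  formA L p q = qdot p q * ldot L L - 2^-1 * qdot (defect L p) (defect L q).
Proof.
move=> tr0 pI qI.
have step i : qdot ((amulr p \o L)%VF (std R i)) ((L \o amull q)%VF (std R i)) =
    qdot (L (std R i)) (L (std R i)) * qdot p q
    + qdot (L (std R i) * p * std R i) (defect L q).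
  rewrite [(_ \o _)%VF _]lfunE [(L \o _)%VF _]lfunE /= [amulr _ _]lfunE.
  rewrite [amull _ _]lfunE /= (lfun_mul_imH _ tr0 qI) qdotDr qdotMl.
  by rewrite qdot_mulr_conj.
rewrite /formA !ldotE (eq_bigr _ (fun i _ => step i)) big_split /=.
rewrite -(qdot_suml (fun i => L (std R i) * p * std R i)) qtrace_mul_imH //.
have -> : \sum_i qdot (L (std R i)) (L (std R i)) * qdot p q =
    (\sum_i qdot (L (std R i)) (L (std R i))) * qdot p q by rewrite mulr_suml.
by rewrite qdotZl; field.
Qed.

(** This makes the trace of A_L equal to 3 |L|^2 - 2 |L|^2 = |L|^2.  As
    T(1) = 0 the sum may run over the full basis; the cross terms
    <L(u), L(1) u> add up to the scalar product with L(1) of the sum of the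
    L(u) conj(u), which is 2 L(1) minus the trace. *)
Lemma defect_normsq L : qtrace L = 0 ->
  \sum_(a < 3) qdot (defect L (imunit R a)) (defect L (imunit R a)) =
  4 * ldot L L.
Proof.
move=> tr0.
have d1 : defect L 1 = 0 by rewrite defectE mulr1 subrr.
have -> : \sum_(a < 3) qdot (defect L (imunit R a)) (defect L (imunit R a)) =
    \sum_i qdot (defect L (std R i)) (defect L (std R i)).
  rewrite [RHS]big_ord_recl (_ : std R ord0 = 1) ?std0 // d1.
  by rewrite linear0 /= add0r.
have L1 : \sum_i L (std R i) * qconj (std R i) = 2 *: L 1.
  under eq_bigr => i _ do rewrite qconjE mulrBr.
  rewrite sumrB -/(qtrace L) tr0 subr0 big_ord_recl /= big1 => [|i _].
    by rewrite (_ : std R ord0 = 1) ?std0 // qre1 mulr1 -scalerAr mulr1 addr0.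
  by rewrite -qdot1r -std0 qdot_std mulr0 scale0r mulr0.
have step i : qdot (defect L (std R i)) (defect L (std R i)) =
    qdot (L (std R i)) (L (std R i))
    - 2 * qdot (L (std R i) * qconj (std R i)) (L 1) + qdot (L 1) (L 1).
  rewrite defectE qdotBl !qdotBr qdotMl qdot_std eqxx mulr1.
  by rewrite (qdotC (L 1 * _)) !qdot_mulr; ring.
rewrite (eq_bigr _ (fun i _ => step i)) big_split big_split /= sumrN.
have -> : \sum_i 2 * qdot (L (std R i) * qconj (std R i)) (L 1) =
    2 * qdot (\sum_i L (std R i) * qconj (std R i)) (L 1).
  by rewrite qdot_suml mulr_sumr.
by rewrite L1 qdotZl sumr_const card_ord ldotE -mulr_natl; field.
Qed.

Lemma imunit_imH a : imunit R a \in imH R.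
Proof. by apply/imHP; rewrite -qdot1r -std0 (qdot_std R (lift ord0 a)). Qed.

Lemma formM_defect L p q : qtrace L = 0 -> p \in imH R -> q \in imH R ->
  formM L p q = 4^-1 * qdot (defect L p) (defect L q).
Proof.
move=> tr0 pI qI; rewrite /formM formA_defect //.
have -> : \tr (gram (formA L) (imunit R)) = ldot L L.
  have step a : gram (formA L) (imunit R) a a =
      ldot L L - 2^-1 * qdot (defect L (imunit R a)) (defect L (imunit R a)).
    rewrite mxE formA_defect ?imunit_imH //.
    by rewrite (qdot_std R (lift ord0 a)) eqxx mul1r.
  rewrite /mxtrace (eq_bigr _ (fun a _ => step a)) big_split /= sumrN.
  have -> : \sum_a 2^-1 * qdot (defect L (imunit R a)) (defect L (imunit R a)) =
      2^-1 * (4 * ldot L L) by rewrite -defect_normsq // mulr_sumr.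
  by rewrite sumr_const card_ord -mulr_natl; field.
by field.
Qed.

(** For L in LinRF, its unit vectors are the g in the sphere such that L is in
    LinC_gg. *)
Definition cspace L : {vspace H} := (imH R :&: lker (defect L))%VS.

Lemma mem_cspace L g : (g \in cspace L) = (g \in imH R) && (defect L g == 0).
Proof. by rewrite memv_cap memv_ker. Qed.

End Trace.

(** * Orthogonal families adapted to a subspace *)

Section OrthogonalSequences.
Variable R : realType.
Local Notation H := (quat R).
Implicit Types (s t : seq H) (V W K : {vspace H}) (x y : H).

Definition orthogonal_seq s :=
  (0 \notin s) && pairwise (fun x y => qdot x y == 0) s.

Definition orthv x : {vspace H} := lker (linfun (qdot x : H -> R^o)).

Lemma mem_orthv x y : (y \in orthv x) = (qdot x y == 0).
Proof. by rewrite memv_ker lfunE. Qed.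

Lemma orthogonal_cons x s : orthogonal_seq (x :: s) =
  [&& x != 0, all (fun y => qdot x y == 0) s & orthogonal_seq s].
Proof.
rewrite /orthogonal_seq /= inE negb_or eq_sym -!andbA; congr (_ && _).
exact: andbCA.
Qed.

Lemma orthogonal_tupleP n (e : n.-tuple H) : orthogonal_seq e <->
  (forall i, tnth e i != 0) /\
  (forall i j, i != j -> qdot (tnth e i) (tnth e j) = 0).
Proof.
rewrite /orthogonal_seq; split=> [/andP[e0 /(pairwiseP 0) orth] | [e0 orth]].
  split=> [i | i j]; first by apply: contraNneq e0 => <-; exact: mem_tnth.
  rewrite -val_eqE neq_ltn !(tnth_nth 0).
  by case/orP=> lij; [|rewrite qdotC]; apply/eqP/orth; rewrite ?inE ?size_tuple.
apply/andP; split.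
  by apply/negP => /tnthP[i /eqP]; rewrite eq_sym (negbTE (e0 i)).
apply/(pairwiseP 0) => i j; rewrite !inE size_tuple => ilt jlt lij.
rewrite -(tnth_nth 0 e (Ordinal ilt)) -(tnth_nth 0 e (Ordinal jlt)) orth //.
by rewrite -val_eqE neq_ltn lij.
Qed.

Lemma orthogonal_free s : orthogonal_seq s -> free s.
Proof.
elim: s => [_|x s IHs]; first exact: nil_free.
rewrite orthogonal_cons free_cons => /and3P[x0 /allP xs /IHs ->].
rewrite andbT; apply: contra x0 => xS; rewrite -qdot_eq0 -mem_orthv.
by apply: subvP xS; apply/span_subvP => y /xs; rewrite mem_orthv.
Qed.

Lemma dim_cap_orthv W x : (\dim W <= (\dim (W :&: orthv x)).+1)%N.
Proof.
rewrite -(limg_ker_dim (linfun (qdot x : H -> R^o)) W) -addn1 leq_add2l.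
by rewrite (leq_trans (dimvS (subvf _))) // dimvf.
Qed.

(** Each member of s cuts the dimension by at most one. *)
Lemma exists_orthogonal V s : (size s < \dim V)%N ->
  exists v, [/\ v \in V, v != 0 & all (fun y => qdot v y == 0) s].
Proof.
move=> ltsV; pose W := foldr (fun x U => U :&: orthv x)%VS V s.
have dimW : (\dim V <= size s + \dim W)%N.
  rewrite /W; elim: (s) => //= x t IHt; apply: leq_trans IHt _.
  by rewrite addSnnS leq_add2l dim_cap_orthv.
exists (vpick W); split; last 1 first.
- have : vpick W \in W by exact: memv_pick.
  rewrite {2}/W; elim: (s) => //= x t IHt; rewrite memv_cap => /andP[/IHt ->].
  by rewrite mem_orthv qdotC => ->.
- have : vpick W \in W by exact: memv_pick.
  by rewrite {2}/W; elim: (s) => //= x t IHt; rewrite memv_cap => /andP[/IHt].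
rewrite vpick0 -dimv_eq0 -lt0n; move: dimW ltsV; lia.
Qed.

Lemma size_free_sub V s : free s -> {subset s <= V} -> (size s <= \dim V)%N.
Proof. by move=> /eqP <- sV; apply/dimvS/span_subvP. Qed.

Lemma orthogonal_extend V s : orthogonal_seq s -> {subset s <= V} ->
  exists t, [/\ orthogonal_seq (t ++ s), {subset t ++ s <= V} &
    size (t ++ s) = \dim V].
Proof.
move: {2}(\dim V - size s)%N (erefl (\dim V - size s)%N) => n.
elim: n s => [|n IHn] s dn os sV.
  exists [::]; split=> //=; apply/eqP; rewrite eqn_leq size_free_sub //=.
    by rewrite -subn_eq0 dn.
  exact: orthogonal_free.
have [|v [vV v0 vs]] := @exists_orthogonal V s; first by rewrite -subn_gt0 dn.
have [||| t [ot tV sz]] := IHn (v :: s).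
- by rewrite /= subnS dn.
- by rewrite orthogonal_cons v0 vs.
- by move=> y; rewrite inE => /predU1P[->|/sV].
by exists (rcons t v); rewrite cat_rcons.
Qed.

Lemma count_free K s : free s -> (count (mem K) s <= \dim K)%N.
Proof.
move=> fs; rewrite -size_filter size_free_sub ?filter_free //.
by move=> y; rewrite mem_filter => /andP[].
Qed.

(** An orthogonal basis of K, extended to an orthogonal basis of V; no
    orthogonal family has more than dim K members in K. *)
Lemma orthogonal_adapted K V : (K <= V)%VS ->
  exists s, [/\ orthogonal_seq s, {subset s <= V}, size s = \dim V &
    count (mem K) s = \dim K].
Proof.
move=> /subvP KV; have [//|//|s0] := @orthogonal_extend K [::].
rewrite cats0 => -[os0 s0K sz0].
have [//|x /s0K /KV //|t [ot tV szt]] := @orthogonal_extend V s0.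
exists (t ++ s0); split=> //; apply/eqP.
rewrite eqn_leq count_free ?orthogonal_free //=.
rewrite count_cat -sz0; apply: leq_trans (leq_addl _ _).
by rewrite leq_eqVlt eq_sym -all_count (introT allP).
Qed.

Lemma orthogonal_scale (c : H -> R) s : (forall x, x != 0 -> c x != 0) ->
  orthogonal_seq s -> orthogonal_seq [seq c x *: x | x <- s].
Proof.
move=> c0; elim: s => // x s IHs.
rewrite !orthogonal_cons => /and3P[x0 /allP xs /IHs os].
apply/and3P; split=> //; first by rewrite scaler_eq0 negb_or c0.
apply/allP => _ /mapP[y /xs /eqP xy ->].
by rewrite qdotZl qdotZr xy !mulr0.
Qed.

Lemma dim_imH : \dim (imH R) = 3%N.
Proof.
apply/eqP; rewrite eqn_leq; apply/andP; split; last first.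
  rewrite -ltnS; have := limg_ker_dim (linfun (@qre R : H -> R^o)) fullv.
  rewrite capfv -/(imH R) dimvf => dE; apply: (@leq_trans 4) => //.
  rewrite -[X in (X <= _)%N]dE -addn1 leq_add2l.
  by rewrite (leq_trans (dimvS (subvf _))) // dimvf.
rewrite -ltnS; have -> : 4%N = \dim {: H} by rewrite dimvf.
rewrite ltn_neqAle dimvS ?subvf // andbT; apply/negP => /eqP dE.
have /eqP fE : (imH R == fullv)%VS by rewrite eqEdim subvf dE leqnn.
have : (1 : H) \in imH R by rewrite fE memvf.
by move=> /imHP/eqP; rewrite qre1 oner_eq0.
Qed.

End OrthogonalSequences.

(** * The numbers c(L) and s(L) *)

Section Invariants.
Variable R : realType.
Local Notation H := (quat R).
Implicit Types (L : 'End(H)) (g p q x y : H).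

Lemma orthonormal_std : orthonormal_basisH [tuple std R i | i < 4].
Proof.
have on : qorthonormal [tuple std R i | i < 4].
  by move=> i j; rewrite !tnth_mktuple qdot_std.
split=> //; rewrite basisEfree subvf size_tuple dimvf leqnn !andbT.
apply/orthogonal_free/orthogonal_tupleP; split=> [i|i j /negbTE ij].
  by rewrite tnth_mktuple std_neq0.
by rewrite on ij.
Qed.

Lemma LinRF_qtrace L : LinRF L <-> qtrace L = 0.
Proof.
split=> [[e [[_ on] _ <-]]|tr0]; first by rewrite qtrace_orthonormal.
have [bas on] := orthonormal_std.
exists [tuple std R i | i < 4]; split=> //; first by rewrite tnth_mktuple std0.
by rewrite qtrace_orthonormal.
Qed.

Lemma cnum_dim L : qtrace L = 0 -> cnum L = \dim (cspace L).
Proof.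
move=> tr0; apply/eqP; rewrite eqn_leq; apply/andP; split.
  apply/bigmax_leqP => k /asboolP[g [fg gL]].
  rewrite -(size_tuple g) size_free_sub // => _ /tnthP[i ->].
  have [/in_sphereP[gI _] /(LinC_defect tr0 gI) dg] := gL i.
  by rewrite mem_cspace gI dg eqxx.
have [//|//|s0] := @orthogonal_extend R (cspace L) [::].
rewrite cats0 => -[os0 sL sz].
have lt5 : (\dim (cspace L) < 5)%N.
  by rewrite ltnS (leq_trans (dimvS (subvf _))) // dimvf.
pose c (x : H) : R := (qnorm x)^-1.
have c_neq0 x : x != 0 -> c x != 0.
  by move=> x0; rewrite invr_eq0 sqrtr_eq0 -ltNge lt_def qdot_eq0 x0 qdot_ge0.
pose s := [seq c x *: x | x <- s0].
have szs : size s == \dim (cspace L) by rewrite size_map sz.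
apply: (@leq_bigmax_cond _ _ _ (Ordinal lt5)); apply/asboolP.
exists (Tuple szs); split=> [|i].
  exact/orthogonal_free/(orthogonal_scale c_neq0).
have /mapP[x xs ->] : tnth (Tuple szs) i \in s by exact: mem_tnth.
have x0 : x != 0 by apply: contraNneq (proj1 (andP os0)) => <-.
have := sL _ xs; rewrite mem_cspace => /andP[xI /eqP dx].
have cxI : c x *: x \in imH R by rewrite memvZ.
split; last by apply/LinC_defect => //; rewrite linearZ /= dx scaler0.
apply/in_sphereP; split=> //.
rewrite qdotZl qdotZr mulrA -expr2 exprVn sqr_sqrtr ?qdot_ge0 //.
by rewrite mulVf ?qdot_eq0.
Qed.

Lemma thetab1 p : p != 0 -> thetab p 1 = 1.
Proof. by move=> p0; rewrite /thetab qconj1 mulr1 mulrV. Qed.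

Lemma thetab_self p : p != 0 -> p \in imH R -> thetab p p = - p.
Proof.
by move=> p0 pI; rewrite /thetab qconj_imH // mulrN mulNr mulrK.
Qed.

Lemma thetab_orth p q : p != 0 -> p \in imH R -> q \in imH R ->
  qdot p q = 0 -> thetab p q = q.
Proof.
move=> p0 pI qI pq; rewrite /thetab qconj_imH // mulrN.
by rewrite -(imH_anticomm pI qI pq) mulrK.
Qed.

Lemma thetabD p x y : thetab p (x + y) = thetab p x + thetab p y.
Proof. by rewrite /thetab linearD /= mulrDr mulrDl. Qed.

Lemma thetabZ p (a : R) x : thetab p (a *: x) = a *: thetab p x.
Proof. by rewrite /thetab linearZ /= -(scalerAr a p) -scalerAl. Qed.

Section OrthogonalBasis.
Variable e : 3.-tuple H.
Hypothesis be : orthogonal_basis_imH e.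

Lemma orth_imH m : tnth e m \in imH R.
Proof. by case: be => be' _; apply: (basis_mem be'); apply: mem_tnth. Qed.

Lemma orth_neq0 m : tnth e m != 0.
Proof.
by case: be => /basis_free fe _; apply: free_not0 fe _; apply: mem_tnth.
Qed.

Lemma sum_thetab1 (lam : 'I_3 -> H) :
  \sum_l lam l * thetab (tnth e l) 1 = \sum_l lam l.
Proof. by apply: eq_bigr => l _; rewrite thetab1 ?orth_neq0 ?mulr1. Qed.

(** The map [thetab (tnth e l)] is the reflection that negates e_l and fixes 1
    and the imaginary quaternions orthogonal to e_l. *)
Lemma sum_thetab (lam : 'I_3 -> H) m :
  \sum_l lam l * thetab (tnth e l) (tnth e m) =
  (\sum_l lam l) * tnth e m - 2 *: (lam m * tnth e m).
Proof.
rewrite mulr_suml (bigD1 m) //= [in RHS](bigD1 m) //=.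
rewrite thetab_self ?orth_neq0 ?orth_imH //.
under eq_bigr => l lm.
  rewrite thetab_orth ?orth_neq0 ?orth_imH ?(proj2 be) //; over.
by rewrite mulrN addrAC scaler_nat mulr2n opprD addrA subrr sub0r.
Qed.

Lemma defect_decomposition L lam m :
  (forall x, L x = \sum_(l < 3) lam l * thetab (tnth e l) x) ->
  defect L (tnth e m) = - 2 *: (lam m * tnth e m).
Proof.
move=> LE; rewrite defectE !LE sum_thetab1 sum_thetab addrAC subrr sub0r.
by rewrite scaleNr.
Qed.

Lemma card_decomposition L lam :
  (forall x, L x = \sum_(l < 3) lam l * thetab (tnth e l) x) ->
  #|[set l | lam l != 0]| = (3 - count (mem (cspace L)) e)%N.
Proof.
move=> LE; rewrite -(map_tnth_enum e) count_map.
have -> : #|[set l | lam l != 0]| =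
    count (predC (fun l => lam l == 0)) (enum 'I_3).
  by rewrite cardsE cardE size_filter enumT.
rewrite -[X in (X - _)%N](size_enum_ord 3).
rewrite -(count_predC (fun l => lam l == 0) (enum 'I_3)).
rewrite (@eq_count _ (preim _ _) (fun l => lam l == 0)) ?addKn // => l.
rewrite /= mem_cspace orth_imH (defect_decomposition _ LE) scaler_eq0.
rewrite oppr_eq0 pnatr_eq0 /=.
apply/eqP/eqP => [/(congr1 (fun y => y / tnth e l))|->].
  by rewrite mul0r mulrK //; apply: orth_neq0.
by rewrite mul0r.
Qed.

(** The relation T(e_m) = - 2 lam_m e_m forces the value of lam_m.  The
    resulting sum agrees with L at 1 because the lam_m add up to L(1), by the
    vanishing of the trace in the orthogonal basis (1, e_1, e_2, e_3); then it
    agrees with L at each e_m as well. *)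
Lemma decomposition_exists L : qtrace L = 0 ->
  exists lam : 'I_3 -> H, forall x, L x = \sum_l lam l * thetab (tnth e l) x.
Proof.
move=> tr0; pose n m := qdot (tnth e m) (tnth e m).
have n0 m : n m != 0 by rewrite qdot_eq0 orth_neq0.
pose lam m : H := 2^-1 *: (L 1 + (n m)^-1 *: (L (tnth e m) * tnth e m)).
have sum_lam : \sum_m lam m = L 1.
  pose f (i : 'I_4) : H := oapp (tnth e) 1 (unlift ord0 i).
  have f0 : f ord0 = 1 by rewrite /f unlift_none.
  have fS m : f (lift ord0 m) = tnth e m by rewrite /f liftK.
  have f_neq0 i : f i != 0.
    case: (unliftP ord0 i) => [m ->|->]; last by rewrite f0 oner_neq0.
    by rewrite fS orth_neq0.
  have f_orth i j : i != j -> qdot (f i) (f j) = 0.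
    case: (unliftP ord0 i) => [l ->|->]; case: (unliftP ord0 j) => [m ->|->] //.
    - by rewrite (inj_eq lift_inj) !fS; apply: (proj2 be).
    - by rewrite fS f0 qdotC imH1 ?orth_imH.
    - by rewrite fS f0 imH1 ?orth_imH.
  have := qtrace_orthogonal L f_neq0 f_orth.
  rewrite tr0 big_ord_recl f0 qdot11 invr1 scale1r mulr1.
  under eq_bigr => m _ do rewrite fS.
  move/eqP; rewrite addrC addr_eq0 => /eqP trE.
  rewrite -scaler_sumr big_split /= trE sumr_const card_ord -scaler_nat.
  rewrite -[X in _ - X]scale1r -scalerBl scalerA.
  by rewrite (_ : 2^-1 * _ = 1) ?scale1r //; field.
have lam_e m : 2 *: (lam m * tnth e m) = L 1 * tnth e m - L (tnth e m).
  rewrite /lam -scalerAl scalerA mulfV ?pnatr_eq0 // scale1r mulrDl.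
  congr (_ + _).
  rewrite -scalerAl -mulrA imH_sqr ?orth_imH // mulrN -scalerAr mulr1 scalerN.
  by rewrite scalerA mulVf // scale1r.
exists lam; pose P x := L x = \sum_l lam l * thetab (tnth e l) x.
have PD x y : P x -> P y -> P (x + y).
  rewrite /P linearD /= => -> ->; rewrite -big_split; apply: eq_bigr => l _ /=.
  by rewrite thetabD mulrDr.
have PZ (a : R) x : P x -> P (a *: x).
  rewrite /P linearZ /= => ->; rewrite scaler_sumr; apply: eq_bigr => l _ /=.
  by rewrite thetabZ scalerAr.
have P1 : P 1 by rewrite /P sum_thetab1.
have Pe m : P (tnth e m).
  by rewrite /P sum_thetab sum_lam lam_e opprB addrC subrK.
have Pim x : x \in imH R -> P x.
  case: (be) => bas _ xI; rewrite (coord_basis bas xI).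
  elim/big_ind: _ => [||i _]; last 1 first.
  - by apply: PZ; rewrite -tnth_nth.
  - by rewrite -(scale0r 1); apply: PZ.
  - exact: PD.
move=> x; rewrite -/(P x) -[x](subrK (qre x *: 1)); apply: PD; last exact: PZ.
by apply/Pim/imHP; rewrite linearB linearZ /= qre1 [_ *: _]mulr1 subrr.
Qed.

End OrthogonalBasis.

Lemma decomposable_bound L k :
  decomposable_with L k -> (3 - \dim (cspace L) <= k)%N.
Proof.
move=> [e [lam [be LE <-]]]; rewrite (card_decomposition be LE).
by rewrite leq_sub2l // count_free // (basis_free (proj1 be)).
Qed.

Lemma decomposable_min L :
  qtrace L = 0 -> decomposable_with L (3 - \dim (cspace L))%N.
Proof.
move=> tr0; have sub_imH : (cspace L <= imH R)%VS by exact: capvSl.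
have [s [os sI sz cK]] := orthogonal_adapted sub_imH.
rewrite dim_imH in sz; pose e := Tuple (introT eqP sz).
have be : orthogonal_basis_imH e.
  split.
    rewrite basisEfree orthogonal_free //= sz dim_imH leqnn andbT.
    exact/span_subvP.
  exact: (proj2 (proj1 (orthogonal_tupleP e) os)).
have [lam LE] := decomposition_exists be tr0.
by exists e, lam; split=> //; rewrite (card_decomposition be LE) cK.
Qed.

(** The minimum is unfolded to a choice among the minimisers, because the
    default value 3 of the search need not itself be the length of a
    decomposition. *)
Lemma size_RF_dim L : qtrace L = 0 -> size_RF L = (3 - \dim (cspace L))%N.
Proof.
move=> tr0; rewrite /size_RF /arg_min /extremum.
have lt4 : (3 - \dim (cspace L) < 4)%N by rewrite ltnS leq_subr.
case: pickP => [i /andP[/asboolP Li /forallP mini]|/(_ (Ordinal lt4))].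
  apply/eqP; rewrite eqn_leq (decomposable_bound Li) andbT.
  have /implyP := mini (Ordinal lt4); apply.
  by apply/asboolP; apply: decomposable_min.
case/negP; apply/andP; split; first by apply/asboolP; apply: decomposable_min.
by apply/forallP => j; apply/implyP => /asboolP /decomposable_bound.
Qed.

End Invariants.

(** * The matrix of M_L as a Gram matrix *)

Section Kernel.
Variable R : realType.
Local Notation H := (quat R).
Variables (L : 'End(H)) (e : 4.-tuple H).
Hypotheses (tr0 : qtrace L = 0) (be : orthonormal_basisH e)
  (e0 : tnth e ord0 = 1).

Definition imcomb (v : 'cV[R]_3) : H := \sum_(a < 3) v a 0 *: impart e a.

Fact imcomb_is_linear : linear imcomb.
Proof.
move=> c u v; rewrite /imcomb scaler_sumr -big_split; apply: eq_bigr => a _ /=.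
by rewrite !mxE scalerDl scalerA.
Qed.
HB.instance Definition _ :=
  GRing.isLinear.Build R 'cV[R]_3 H _ imcomb imcomb_is_linear.

Lemma impart_orthonormal a b : qdot (impart e a) (impart e b) = (a == b)%:R.
Proof. by rewrite (proj2 be) (inj_eq lift_inj). Qed.

Lemma impart_imH a : impart e a \in imH R.
Proof. by apply/imHP; rewrite -qdot1r -e0 (proj2 be). Qed.

Lemma imcomb_imH v : imcomb v \in imH R.
Proof. by apply: memv_suml => a _; rewrite memvZ ?impart_imH. Qed.

Lemma qdot_imcomb v a : qdot (imcomb v) (impart e a) = v a 0.
Proof.
rewrite qdot_suml (bigD1 a) //= big1 => [|b ba].
  by rewrite qdotZl impart_orthonormal eqxx mulr1 addr0.
by rewrite qdotZl impart_orthonormal (negbTE ba) mulr0.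
Qed.

Lemma imcomb_coord x : x \in imH R ->
  x = imcomb (\col_a qdot x (impart e a)).
Proof.
move=> xI; have [bas on] := be.
have xE : x = \sum_(i < 4) coord e i x *: tnth e i.
  rewrite {1}(coord_basis bas (memvf x)); apply: eq_bigr => i _.
  by rewrite (tnth_nth 0).
have cE i : coord e i x = qdot x (tnth e i).
  rewrite {2}xE qdot_suml (bigD1 i) //= big1 => [|j ji].
    by rewrite qdotZl on eqxx mulr1 addr0.
  by rewrite qdotZl on (negbTE ji) mulr0.
rewrite {1}xE big_ord_recl e0 cE e0 qdot1r (imHP _ xI) scale0r add0r.
by apply: eq_bigr => a _; rewrite mxE cE.
Qed.

Lemma matM_mulE v a :
  (matM L e *m v) a 0 =
  4^-1 * qdot (defect L (impart e a)) (defect L (imcomb v)).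
Proof.
rewrite mxE /imcomb linear_sum qdot_sumr mulr_sumr; apply: eq_bigr => b _.
rewrite mxE formM_defect ?impart_imH // linearZ /= qdotZr.
by rewrite mulrCA mulrC mulrA mulrAC.
Qed.

(** The matrix is a Gram matrix: if M v = 0 then |T(sum v_a e_a)|^2 = 4 v^T M v
    vanishes. *)
Lemma cker_defect v : (v \in cker (matM L e)) = (defect L (imcomb v) == 0).
Proof.
apply/ckerP/eqP => [Mv0|d0]; last first.
  by apply/colP => a; rewrite matM_mulE d0 mxE linear0 mulr0.
have dE : defect L (imcomb v) = \sum_a v a 0 *: defect L (impart e a).
  by rewrite linear_sum; apply: eq_bigr => a _; rewrite linearZ.
apply/eqP; rewrite -qdot_eq0 {1}dE qdot_suml big1 // => a _.
apply/eqP; rewrite qdotZl mulf_eq0; apply/orP; right.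
have := congr1 (fun w : 'cV_3 => w a 0) Mv0.
by rewrite matM_mulE mxE => /eqP; rewrite mulf_eq0 invr_eq0 pnatr_eq0.
Qed.

Lemma dim_cker : \dim (cker (matM L e)) = \dim (cspace L).
Proof.
rewrite -(@limg_dim_eq _ _ _ (linfun imcomb)).
  congr (\dim _); apply/vspaceP => x; apply/memv_imgP/idP => [[v vK ->]|].
    by rewrite lfunE mem_cspace imcomb_imH -cker_defect.
  rewrite mem_cspace => /andP[xI dx]; exists (\col_a qdot x (impart e a)).
    by rewrite cker_defect -imcomb_coord.
  by rewrite lfunE /= -imcomb_coord.
apply/eqP; rewrite -subv0; apply/subvP => v; rewrite memv_cap => /andP[_].
rewrite memv_ker lfunE memv0 => /eqP v0; apply/eqP/colP => a.
by rewrite mxE -qdot_imcomb [imcomb v]v0 qdotC linear0.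
Qed.

End Kernel.

Theorem theorem3p14 (R : realType) (Lambda : 'End(quat R)) :
  ((exists g : quat R, in_sphere g /\ LinC g g Lambda) -> LinRF Lambda) /\
  (LinRF Lambda ->
   forall e : 4.-tuple (quat R), orthonormal_basisH e -> tnth e ord0 = 1 ->
   [/\ forall v : 'cV[R]_3,
         let g := \sum_(a < 3) v a 0 *: impart e a in
         in_sphere g ->
         (LinC g g Lambda <-> formM Lambda g g = 0) /\
         (formM Lambda g g = 0 <-> v \in cker (matM Lambda e)),
       cnum Lambda = \dim (cker (matM Lambda e)) &
       cnum Lambda = (3 - size_RF Lambda)%N]).
Proof.
split=> [[g [gS /(qtrace_LinC gS) tr0]]|/LinRF_qtrace tr0 e be e0].
  exact/LinRF_qtrace.
split=> [v g gS||]; last first.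
- by rewrite cnum_dim // size_RF_dim // subKn // -(dim_imH R) dimvS ?capvSl.
- by rewrite cnum_dim // dim_cker.
have [gI _] := proj1 (in_sphereP g) gS.
rewrite formM_defect // (cker_defect tr0 be e0) LinC_defect //.
have -> : 4^-1 * qdot (defect Lambda g) (defect Lambda g) = 0 <->
    defect Lambda g = 0.
  split=> [/eqP|->]; last by rewrite linear0 mulr0.
  by rewrite mulf_eq0 invr_eq0 pnatr_eq0 qdot_eq0 => /eqP.
by split=> //; split=> /eqP.
Qed.
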